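(* Let $n\ge 2$, let $1\le p\le 2n-1$, and put $d:=\gcd(p,2n-1)$. The characteristic polynomial (in the variable $\lambda$) of the linear operator $A(\tau_p)$ on $H^\bullet(\mathrm{OG})$ is \[ \begin{cases} \lambda\left(\lambda^{\frac{2n-1}{d}}-2^{\frac{2p}{d}}\right)^{d} & \text{if } 1\le p<n,\\[4pt] \lambda\left(\lambda^{\frac{2n-1}{d}}-2^{\frac{2p-(2n-1)}{d}}\right)^{d} & \text{if } n\le p<2n-1,\\[4pt] (\lambda-1)^{2n-1}(\lambda+1) & \text{if } p=2n-1. \end{cases} \] In particular, the eigenvalues of $A(\tau_p)$ are all simple if and only if $p$ and $2n-1$ are relatively prime.
   Context: Let $n\ge 2$ and let $\mathrm{OG}=\mathrm{OG}(1,2n+1)\subset\mathbb{P}(\mathbb{C}^{2n+1})$ be the $(2n-1)$-dimensional quadric of isotropic lines through the origin in $\mathbb{C}^{2n+1}$ for the symmetric form $(a,b)=\sum_{i=1}^{2n+1}a_i b_{2n+2-i}$; equivalently, the zero locus of $v_{n+1}^2+2\sum_{i=1}^n v_iv_{2n+2-i}$. For $0\le p\le n-1$ let $X(p)=\mathrm{OG}\cap\{v_1=\dots=v_p=0\}$ and for $n\le p\le 2n-1$ let $X(p)=\mathrm{OG}\cap\{v_1=\dots=v_{p+1}=0\}$; these are the Schubert varieties, $X(p)$ has codimension $p$ in $\mathrm{OG}$, and $\tau_p:=[X(p)]$ is its Schubert class. The Poincaré dual of $\tau_j$ is $\tau_{2n-1-j}$. The (small) quantum cohomology ring $(\mathrm{QH}^*(\mathrm{OG}),\star)$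 is the graded commutative associative $\mathbb{Z}[q]$-algebra with $\mathbb{Z}[q]$-basis $\tau_0,\dots,\tau_{2n-1}$, $\deg\tau_p=p$, $\deg q=2n-1$, and unit $\tau_0$, with product $\tau_p\star\tau_i=\sum_{j,d_0\ge 0}c_{p,i}^{j,d_0}q^{d_0}\tau_j$, where $c_{p,i}^{j,d_0}$ is the Gromov–Witten invariant enumerating degree $d_0$ rational curves meeting general translates of $X(p)$, $X(i)$, $X(2n-1-j)$. It satisfies the known quantum Chevalley formula: $\tau_1\star\tau_p=\tau_{p+1}$ for $0\le p\le n-2$; $\tau_1\star\tau_{n-1}=2\tau_n$; $\tau_1\star\tau_p=\tau_{p+1}$ for $n\le p\le 2n-3$; $\tau_1\star\tau_{2n-2}=\tau_{2n-1}+q\tau_0$; $\tau_1\star\tau_{2n-1}=q\tau_1$. Together with associativity and the unit $\tau_0$, this determines the product. $H^\bullet(\mathrm{OG})$ denotes the specialization of $\mathrm{QH}^*(\mathrm{OG})$ at $q=1$, regarded as a $2n$-dimensional complex vector space with basis $\tau_0,\dots,\tau_{2n-1}$, and $A(\tau_p)$ is the endomorphism $y\mapsto(\tau_p\star y)|_{q=1}$ of $H^\bullet(\mathrm{OG})$. *)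

(* Defs.v *)
From mathcomp Require Import all_boot all_order all_algebra.
From mathcomp Require mpoly.

Set Implicit Arguments.
Unset Strict Implicit.
Unset Printing Implicit Defensive.

Import Order.TTheory GRing.Theory Num.Theory.
Local Open Scope ring_scope.

Section OrthogonalGrassmannian.
Variables (C : numClosedFieldType) (n : nat).

(* Coordinates are 0-based: the coordinate v_i (1 <= i <= 2n+1) is
   [v 0 k] with [k = i - 1], so
   that v_(2n+2-i) is [v 0 (rev_ord k)]. *)
Definition symform (a b : 'rV[C]_((2 * n).+1)) : C :=
  \sum_i a 0 i * b 0 (rev_ord i).

(* Homogeneous coordinate vectors of the points of OG. *)
Definition in_OG (v : 'rV[C]_((2 * n).+1)) : Prop := v != 0 /\ symform v v = 0.

Definition in_schubert (p : nat) (v : 'rV[C]_((2 * n).+1)) : Prop :=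
  in_OG v /\
  forall i : 'I_((2 * n).+1), (i < (if p < n then p else p.+1))%N -> v 0 i = 0.

Definition in_SO (g : 'M[C]_((2 * n).+1)) : Prop :=
  \det g = 1 /\ forall a b, symform (a *m g) (b *m g) = symform a b.

Definition in_translate (g : 'M[C]_((2 * n).+1)) (p : nat)
  (v : 'rV[C]_((2 * n).+1)) : Prop := in_schubert p (v *m invmx g).

(* A map P^1 -> P^(2n) of degree d is given, up to a nonzero scalar, by 2n+1
   binary forms of degree d without common zero; row k of [f] contains their
   coefficients of s^k t^(d-k). *)
Definition curve_eval (d : nat) (f : 'M[C]_(d.+1, (2 * n).+1)) (s t : C) :
  'rV[C]_((2 * n).+1) := \sum_(k < d.+1) (s ^+ k * t ^+ (d - k)) *: row k f.

Definition is_curve (d : nat) (f : 'M[C]_(d.+1, (2 * n).+1)) : Prop :=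
  forall s t : C, (s, t) != (0, 0) -> in_OG (curve_eval f s t).

(* Degree d rational curves in OG with three marked points, on the given
   translates of X(p1), X(p2), X(p3). The marked points are distinct for general
   translates, and Aut(P^1) is used up by placing them at 0, 1 and oo. *)
Definition curve_meets (p1 p2 p3 d : nat) (g1 g2 g3 : 'M[C]_((2 * n).+1))
    (f : 'M[C]_(d.+1, (2 * n).+1)) : Prop :=
  [/\ is_curve f,
      in_translate g1 p1 (curve_eval f 0 1),
      in_translate g2 p2 (curve_eval f 1 1) &
      in_translate g3 p3 (curve_eval f 1 0)].

Definition num_up_to_scaling (k l : nat) (S : 'M[C]_(k, l) -> Prop)
    (m : nat) : Prop :=
  exists2 f : 'I_m -> 'M[C]_(k, l),
    forall i, S (f i) &
    forall h, S h -> exists! i, exists2 a : C, a != 0 & h = a *: f i.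

(* A property of triples in SO is general when it holds on a nonempty principal
   Zariski-open subset P <> 0 of SO x SO x SO. *)
Definition general_SO3
    (Q : 'M[C]_((2 * n).+1) -> 'M[C]_((2 * n).+1) -> 'M[C]_((2 * n).+1) -> Prop) :
    Prop :=
  let N := (2 * n).+1 in
  exists P : mpoly.mpoly ((N + N + N) * N) C,
    let P_at g1 g2 g3 :=
      mpoly.meval (fun k => mxvec (col_mx (col_mx g1 g2) g3) 0 k) P in
    (exists g1 g2 g3 : 'M[C]_N,
       [/\ in_SO g1, in_SO g2, in_SO g3 & P_at g1 g2 g3 != 0]) /\
    (forall g1 g2 g3 : 'M[C]_N,
       in_SO g1 -> in_SO g2 -> in_SO g3 -> P_at g1 g2 g3 != 0 -> Q g1 g2 g3).

(* [m] is the Gromov-Witten invariant <tau_p1, tau_p2, tau_p3>_d. This is meant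
   for p1 + p2 + p3 = (2n-1)(d+1), the dimension of the moduli space of degree d
   maps with three marked points, where the number of curves is finite. *)
Definition is_GW (p1 p2 p3 d m : nat) : Prop :=
  general_SO3 (fun g1 g2 g3 =>
    num_up_to_scaling (@curve_meets p1 p2 p3 d g1 g2 g3) m).

End OrthogonalGrassmannian.

Section QuantumProduct.
Variable n : nat.

(* The free Z[q]-module on tau_0, ..., tau_(2n-1), with q = 'X. *)
Definition QH := 'rV[{poly int}]_(2 * n).

Definition tau (p : nat) : QH := \row_(j < 2 * n) (p == j :> nat)%:R.

(* The coefficient of q^d in [c p i j] is the structure constant
   c_(p,i)^(j,d). *)
Variable c : 'I_(2 * n) -> 'I_(2 * n) -> 'I_(2 * n) -> {poly int}.

Definition star (x y : QH) : QH :=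
  \row_j \sum_p \sum_i x 0 p * y 0 i * c p i j.

End QuantumProduct.

(* [c] is the family of structure constants of the small quantum cohomology ring
   of OG(1, 2n+1): the field [qh_GW] is its definition, the others are the known
   properties of this ring. Note that [rev_ord j] is 2n-1-j. *)
Record quantum_cohomology (C : numClosedFieldType) (n : nat)
    (c : 'I_(2 * n) -> 'I_(2 * n) -> 'I_(2 * n) -> {poly int}) : Prop := {
  qh_GW : forall (p i j : 'I_(2 * n)) (d : nat),
    (p + i = j + (2 * n - 1) * d)%N ->
    exists2 m : nat, is_GW C n p i (rev_ord j) d m & (c p i j)`_d = m%:Z;
  qh_graded : forall (p i j : 'I_(2 * n)) (d : nat),
    (p + i)%N <> (j + (2 * n - 1) * d)%N -> (c p i j)`_d = 0;
  qh_starC : commutative (star c);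
  qh_starA : associative (star c);
  qh_star1 : left_id (tau n 0) (star c);
  qh_chevalley_low : forall p : nat, (p + 2 <= n)%N ->
    star c (tau n 1) (tau n p) = tau n p.+1;
  qh_chevalley_mid : star c (tau n 1) (tau n (n - 1)) = tau n n *+ 2;
  qh_chevalley_high : forall p : nat, (n <= p <= 2 * n - 3)%N ->
    star c (tau n 1) (tau n p) = tau n p.+1;
  qh_chevalley_line :
    star c (tau n 1) (tau n (2 * n - 2)) = tau n (2 * n - 1) + 'X *: tau n 0;
  qh_chevalley_point :
    star c (tau n 1) (tau n (2 * n - 1)) = 'X *: tau n 1
}.

Definition at_q1 (C : numClosedFieldType) (n : nat) (x : QH n) :
  'rV[C]_(2 * n) := map_mx (fun P : {poly int} => (P.[1])%:~R) x.

(* Matrix of A(tau_p) in the basis tau_0, ..., tau_(2n-1) of H(OG), acting on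
   row vectors: row i is the image of tau_i. *)
Definition quantum_mult (C : numClosedFieldType) (n : nat)
    (c : 'I_(2 * n) -> 'I_(2 * n) -> 'I_(2 * n) -> {poly int}) (p : nat) :
    'M[C]_(2 * n) :=
  \matrix_(i < 2 * n) at_q1 C (star c (tau n p) (tau n i)).

(* Main.v *)
Require Import Defs.
From mathcomp Require Import all_boot all_order all_algebra.
From mathcomp Require Import separable cyclotomic cyclic.
From mathcomp Require Import zify.
From mathcomp Require Import reals.
From mathcomp.real_closed Require Import complex.

Set Implicit Arguments.
Unset Strict Implicit.
Unset Printing Implicit Defensive.

Import Order.TTheory GRing.Theory Num.Theory.
Local Open Scope ring_scope.

(** The idea is to diagonalise all the operators A(tau_p) at once, by means of
    the characters of the commutative algebra H(OG), i.e., its algebra maps to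
    the base field.

    Put N := 2n - 1. At q = 1 the Chevalley formula expresses every Schubert
    class as a polynomial in tau_1: tau_p = f_p(tau_1), where f_p is X^p for
    p < n, X^p / 2 for n <= p < N, and X^N / 2 - 1 for p = N
    ([schubert_poly]). The last case of the formula, tau_1 * tau_N = tau_1, then
    becomes the single relation tau_1^(2n) = 4 tau_1, so a character sends tau_1
    to a root mu of X^(2n) = 4 X. Conversely, for each such mu the linear form
    tau_p |-> f_p(mu) is multiplicative ([character_star_tau]).

    Multiplicativity means that the column (f_i(mu))_i is an eigenvector of the
    matrix of A(tau_p), with eigenvalue f_p(mu). The equation X^(2n) = 4 X has
    2n distinct roots, and deg f_i = i, so these columns form a basis, by
    Vandermonde ([unitmx_horner]). Hence the characteristic polynomial of
    A(tau_p) is the product of the X - f_p(mu) ([char_poly_quantum_mult]).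

    It remains to compute this product. The roots mu are 0 and the
    alpha z^k with alpha^N = 4, z a primitive N-th root of unity and k < N. Up to
    a translation by 1 when p = N, their images under f_p are 0 and the b y^k,
    where y = z^p is a primitive root of unity of order m = N / d, so that the
    geometric progression b y^k runs d times through the roots of X^m - b^m
    ([prod_shifted_geometric]). The spectrum is simple exactly when there is no
    repetition, i.e., when m = N ([uniq_geometric]). *)

(** * Geometric progressions of roots of unity *)

(** X^m - 1 is separable in characteristic 0, so that in a closed field it has m
    distinct roots; a finite group of units of a field being cyclic, one of them
    generates the others. *)
Lemma closed_prim_root_exists (C : numClosedFieldType) (m : nat) :
  (0 < m)%N -> exists z : C, m.-primitive_root z.
Proof.
move=> m_gt0; have [rs] := closed_field_poly_normal ('X^m - 1 : {poly C}).
rewrite (monicP (monicXnsubC 1 m_gt0)) scale1r => def_rs.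
have uniq_rs : uniq rs.
  rewrite -separable_prod_XsubC -def_rs separable_Xn_sub_1 //.
  by rewrite pnatr_eq0 -lt0n.
have root_rs : all m.-unity_root rs.
  by apply/allP=> x; rewrite -root_prod_XsubC -def_rs.
have size_rs : (m <= size rs)%N.
  by rewrite -ltnS -(size_prod_XsubC rs id) -def_rs size_XnsubC.
have /hasP[z _ prim_z] := has_prim_root m_gt0 root_rs uniq_rs size_rs.
by exists z.
Qed.

(** The progression first repeats itself at k = m, where it returns to b. *)
Lemma uniq_geometric (F : fieldType) (m : nat) (z b : F) (N : nat) :
  m.-primitive_root z -> b != 0 ->
  uniq [seq b * z ^+ k | k <- iota 0 N] = (N <= m)%N.
Proof.
move=> prim_z b_neq0; have m_gt0 := prim_order_gt0 prim_z.
apply/idP/idP => [uniq_s | leNm].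
  rewrite leqNgt; apply/negP => ltmN; have lt0N := ltn_trans m_gt0 ltmN.
  have: nth 0 [seq b * z ^+ k | k <- iota 0 N] 0
      == nth 0 [seq b * z ^+ k | k <- iota 0 N] m.
    rewrite !(nth_map 0%N) ?size_iota // !nth_iota // !add0n.
    by rewrite (prim_expr_order prim_z) expr0.
  by rewrite nth_uniq ?size_map ?size_iota // ltn_eqF.
rewrite map_inj_in_uniq ?iota_uniq // => i j.
rewrite !mem_iota !add0n /= => ltiN ltjN /(mulfI b_neq0)/eqP.
rewrite (eq_prim_root_expr prim_z) !modn_small ?(leq_trans _ leNm) //.
by move/eqP.
Qed.

Lemma geometric_neq0 (F : fieldType) (m : nat) (z b : F) (s : seq nat) :
  m.-primitive_root z -> b != 0 -> 0 \notin [seq b * z ^+ k | k <- s].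
Proof.
move=> prim_z b_neq0; apply/negP => /mapP[k _ /esym/eqP].
rewrite mulf_eq0 (negPf b_neq0) expf_eq0 (prim_root_eq0 prim_z).
by rewrite (gtn_eqF (prim_order_gt0 prim_z)) andbF.
Qed.

Lemma prod_geometric (F : fieldType) (m : nat) (z b : F) (Y : {poly F}) :
  m.-primitive_root z -> b != 0 ->
  \prod_(k <- iota 0 m) (Y - (b * z ^+ k)%:P) = Y ^+ m - (b ^+ m)%:P.
Proof.
move=> prim_z b_neq0; have m_gt0 := prim_order_gt0 prim_z.
(* The identity for the indeterminate gives the others by substitution. *)
suff factorX : 'X^m - (b ^+ m)%:P
    = \prod_(k <- iota 0 m) ('X - (b * z ^+ k)%:P).
  have := congr1 (comp_poly Y) factorX.
  rewrite rmorph_prod /= comp_polyB comp_polyC comp_Xn_poly => ->.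
  by apply: eq_bigr => k _; rewrite comp_polyB comp_polyX comp_polyC.
rewrite [LHS](@all_roots_prod_XsubC _ _ [seq b * z ^+ k | k <- iota 0 m]).
- by rewrite (monicP (monicXnsubC _ m_gt0)) scale1r big_map.
- by rewrite size_XnsubC // size_map size_iota.
- apply/allP => _ /mapP[k _ ->]; rewrite /root !hornerE /=.
  by rewrite exprMn exprAC (prim_expr_order prim_z) expr1n mulr1 subrr.
- by rewrite uniq_rootsE (uniq_geometric _ prim_z).
Qed.

Lemma prod_periodic (R : comNzRingType) (m d : nat) (F : nat -> R) :
    (forall k, F (m + k)%N = F k) ->
  \prod_(k <- iota 0 (d * m)) F k = (\prod_(k <- iota 0 m) F k) ^+ d.
Proof.
move=> perF; elim: d => [|d IHd]; first by rewrite big_nil.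
rewrite mulSn iotaD big_cat exprS -IHd add0n; congr (_ * _).
rewrite -[X in iota X (d * m)]addn0 iotaDl big_map; exact: eq_bigr.
Qed.

(** The form taken by the spectrum of all the A(tau_p): over d periods of the
    progression the factor X^m - b^m occurs d times, and subtracting e from the
    roots substitutes X + e for X. *)
Lemma prod_shifted_geometric (F : fieldType) (m d : nat) (y b e : F) :
    m.-primitive_root y -> b != 0 ->
  \prod_(x <- [seq x - e | x <- 0 :: [seq b * y ^+ k | k <- iota 0 (d * m)]])
      ('X - x%:P)
    = ('X + e%:P) * (('X + e%:P) ^+ m - (b ^+ m)%:P) ^+ d.
Proof.
move=> prim_y b_neq0; rewrite /= big_cons !big_map sub0r polyCN opprK.
congr (_ * _); rewrite -(prod_geometric _ prim_y b_neq0) -prod_periodic.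
  by apply: eq_bigr => k _; rewrite polyCB opprB addrA.
by move=> k; rewrite exprD (prim_expr_order prim_y) mul1r.
Qed.

(** * Diagonalisation and simple spectra *)

(** Expanding in powers of the variable factors the matrix as a triangular matrix
    of coefficients, whose diagonal consists of the leading coefficients, times
    the Vandermonde matrix of distinct points. *)
Lemma unitmx_horner (F : fieldType) (m : nat) (f : nat -> {poly F})
    (xs : seq F) :
    (forall i, (i < m)%N -> size (f i) = i.+1) -> uniq xs -> size xs = m ->
  \matrix_(i < m, j < m) (f i).[xs`_j] \in unitmx.
Proof.
move=> size_f uniq_xs size_xs.
have -> : \matrix_(i < m, j < m) (f i).[xs`_j]
    = (\matrix_(i, k) (f i)`_k) *m Vandermonde m (\row_j xs`_j).
  apply/matrixP => i j; rewrite !mxE (@horner_coef_wide _ m) ?size_f //.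
  by apply: eq_bigr => k _; rewrite !mxE.
rewrite unitmx_mul; apply/andP; split; rewrite unitmxE unitfE.
  rewrite det_trig; last first.
    by apply/is_trig_mxP => i j ltij; rewrite mxE nth_default ?size_f.
  apply/prodf_neq0 => i _; rewrite mxE.
  have -> : (f i)`_i = lead_coef (f i) by rewrite lead_coefE size_f.
  by rewrite lead_coef_eq0 -size_poly_eq0 size_f.
rewrite det_Vandermonde; apply/prodf_neq0 => i _; apply/prodf_neq0 => j ltij.
by rewrite !mxE subr_eq0 nth_uniq ?size_xs // gtn_eqF.
Qed.

Lemma char_poly_eigenbasis (F : fieldType) (m : nat) (A W : 'M[F]_m)
    (v : 'rV[F]_m) :
  W \in unitmx -> A *m W = W *m diag_mx v ->
  char_poly A = \prod_(i < m) ('X - (v 0 i)%:P).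
Proof.
move=> unitW AW.
have detCW : \det (map_mx polyC W) != 0.
  by rewrite det_map_mx polyC_eq0 -unitfE -unitmxE.
have -> : \prod_(i < m) ('X - (v 0 i)%:P) = char_poly (diag_mx v).
  rewrite char_poly_trig ?diag_mx_is_trig //.
  by apply: eq_bigr => i _; rewrite mxE eqxx.
apply: (mulIf detCW); rewrite [RHS]mulrC -!det_mulmx; congr (\det _).
rewrite /char_poly_mx mulmxBl mulmxBr -!map_mxM AW.
by rewrite scalar_mxC.
Qed.

Lemma mup_prod_XsubC (F : fieldType) (a : F) (xs : seq F) :
  mup a (\prod_(x <- xs) ('X - x%:P)) = count_mem a xs.
Proof.
elim: xs => [|x xs IHxs]; first by rewrite big_nil mupNroot // root1.
rewrite big_cons mupM ?polyXsubC_eq0 //; last first.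
  by rewrite monic_neq0 // monic_prod_XsubC.
by rewrite IHxs -[X in mup a X]expr1 mup_XsubCX /=; case: eqP.
Qed.

(** The multiplicity of an eigenvalue is its number of occurrences among the
    roots. *)
Lemma simple_spectrum (F : fieldType) (m : nat) (A : 'M[F]_m) (xs : seq F) :
    char_poly A = \prod_(x <- xs) ('X - x%:P) ->
  (forall a, eigenvalue A a -> mup a (char_poly A) = 1%N) <-> uniq xs.
Proof.
move=> def_char; split=> [simple | uniq_xs a].
  apply: count_mem_uniq => a; rewrite -mup_prod_XsubC -def_char.
  have := simple a; rewrite eigenvalue_root_char def_char root_prod_XsubC.
  case: (boolP (a \in xs)) => [_ -> // | /count_memPn].
  by rewrite mup_prod_XsubC.
rewrite eigenvalue_root_char def_char root_prod_XsubC => a_xs.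
by rewrite mup_prod_XsubC count_uniq_mem ?a_xs.
Qed.

(** * Characters of the quantum cohomology ring at q = 1 *)

Section Characters.

Variables (C : numClosedFieldType) (n : nat).

(** The polynomial that gives tau_p in terms of tau_1 at q = 1. The factor 1/2
    comes from tau_1 * tau_(n-1) = 2 tau_n, and the constant term -1 of the last
    polynomial from tau_1 * tau_(2n-2) = tau_(2n-1) + q. *)
Definition schubert_poly (p : nat) : {poly C} :=
  (if (p < n)%N then 1 else 2^-1) *: 'X^p - ((p == 2 * n - 1)%N%:R)%:P.

(** The linear form tau_j |-> f_j(mu) on the specialisation at q = 1, pulled
    back to QH. It is multiplicative when mu^(2n) = 4 mu. *)
Definition character (mu : C) (x : QH n) : C :=
  \sum_(j < 2 * n) ((x 0 j).[1])%:~R * (schubert_poly j).[mu].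

Lemma size_schubert_poly p : (0 < n)%N -> size (schubert_poly p) = p.+1.
Proof.
move=> n_gt0; rewrite /schubert_poly.
set a : C := if _ then _ else _.
have size_aXp : size (a *: 'X^p) = p.+1.
  rewrite size_scale ?size_polyXn // /a.
  by case: ifP => _; rewrite ?oner_eq0 // invr_eq0 pnatr_eq0.
rewrite size_polyDl // size_aXp size_polyN ltnS.
have [-> | _] := eqVneq p (2 * n - 1)%N; last by rewrite size_poly0.
by apply: leq_trans (size_polyC_leq1 _) _; lia.
Qed.

Lemma character_linear mu (a : {poly int}) (x y : QH n) :
  character mu (a *: x + y) = (a.[1])%:~R * character mu x + character mu y.
Proof.
rewrite /character mulr_sumr -big_split; apply: eq_bigr => j _ /=.
by rewrite !mxE hornerD hornerM intrD intrM mulrDl mulrA.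
Qed.

Lemma character_tau mu p : (p < 2 * n)%N ->
  character mu (tau n p) = (schubert_poly p).[mu].
Proof.
move=> ltp; rewrite /character (bigD1 (Ordinal ltp)) //= big1 => [|j neq_j].
  by rewrite mxE eqxx hornerC mul1r addr0.
rewrite mxE; case: eqP => [eq_pj | _]; last by rewrite horner0 mul0r.
by case/eqP: neq_j; apply: val_inj.
Qed.

Lemma character0 mu : character mu 0 = 0.
Proof. by rewrite /character big1 // => j _; rewrite mxE horner0 mul0r. Qed.

Lemma characterD mu x y :
  character mu (x + y) = character mu x + character mu y.
Proof. by rewrite -[x]scale1r character_linear hornerC mul1r scale1r. Qed.

Variable c : 'I_(2 * n) -> 'I_(2 * n) -> 'I_(2 * n) -> {poly int}.

Lemma star_linear x (a : {poly int}) (y z : QH n) :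
  star c x (a *: y + z) = a *: star c x y + star c x z.
Proof.
apply/rowP => j; rewrite !mxE mulr_sumr -big_split; apply: eq_bigr => p _ /=.
rewrite mulr_sumr -big_split; apply: eq_bigr => i _ /=.
by rewrite !mxE mulrDr mulrDl mulrCA !mulrA.
Qed.

Lemma starD x y z : star c x (y + z) = star c x y + star c x z.
Proof. by rewrite -[y]scale1r star_linear !scale1r. Qed.

Lemma star0 x : star c x 0 = 0.
Proof.
by have := star_linear x (-1) 0 0; rewrite scaler0 addr0 scaleN1r addNr.
Qed.

Hypothesis n_ge2 : (2 <= n)%N.
Hypothesis hc : quantum_cohomology C c.
Variable mu : C.
Hypothesis mu_root : mu ^+ (2 * n) = 4 * mu.

Lemma schubert_poly_low p : (p < n)%N -> (schubert_poly p).[mu] = mu ^+ p.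
Proof.
move=> ltpn; rewrite /schubert_poly ltpn ltn_eqF; last by lia.
by rewrite scale1r subr0 hornerXn.
Qed.

Lemma schubert_poly_high p : (n <= p < 2 * n - 1)%N ->
  (schubert_poly p).[mu] = mu ^+ p / 2.
Proof.
move=> /andP[lenp ltp]; rewrite /schubert_poly ltnNge lenp ltn_eqF //=.
by rewrite subr0 hornerZ hornerXn mulrC.
Qed.

Lemma schubert_poly_top :
  (schubert_poly (2 * n - 1)).[mu] = mu ^+ (2 * n - 1) / 2 - 1.
Proof.
rewrite /schubert_poly eqxx ifN; last by lia.
by rewrite hornerD hornerN hornerC hornerZ hornerXn mulrC.
Qed.

(** This is the Chevalley formula case by case: each case but the last is the
    recursion that defines the polynomials f_p. In the last one, p = 2n - 1, one
    has tau_1 * tau_p = q tau_1, which requires mu (mu^(2n-1) / 2 - 1) = mu, and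
    this is the equation satisfied by mu. *)
Lemma character_star_tau1_tau p : (p < 2 * n)%N ->
  character mu (star c (tau n 1) (tau n p)) = mu * character mu (tau n p).
Proof.
move=> ltp; have [n0 n1] : (0 < 2 * n)%N /\ (1 < 2 * n)%N by lia.
have [lep | ltp1] := leqP (p + 2) n.
  rewrite (qh_chevalley_low hc) // !character_tau //; last by lia.
  by rewrite !schubert_poly_low ?exprS //; lia.
have [-> | neqp] := eqVneq p (n - 1)%N.
  rewrite (qh_chevalley_mid hc) mulr2n characterD !character_tau //; try lia.
  rewrite (@schubert_poly_high n) ?schubert_poly_low; try lia.
  rewrite -mulr2n -[LHS]mulr_natr divfK ?pnatr_eq0 //.
  by rewrite -exprS subn1 prednK // (ltn_trans _ n_ge2).
have [lep | ltp2] := leqP p (2 * n - 3).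
  have leprange : (n <= p <= 2 * n - 3)%N by lia.
  rewrite (qh_chevalley_high hc) // !character_tau //; last by lia.
  by rewrite !schubert_poly_high ?exprS ?mulrA //; lia.
have [-> | neqp2] := eqVneq p (2 * n - 2)%N.
  rewrite (qh_chevalley_line hc) addrC character_linear.
  rewrite !character_tau //; try lia.
  rewrite hornerX mul1r schubert_poly_top schubert_poly_low; last by lia.
  rewrite schubert_poly_high; last by lia.
  by rewrite expr0 addrC subrK mulrA -exprS; congr (_ ^+ _ / _); lia.
have -> : p = (2 * n - 1)%N by lia.
rewrite (qh_chevalley_point hc) -['X *: _]addr0 character_linear.
rewrite character0 addr0.
rewrite hornerX mul1r !character_tau //; try lia.
rewrite schubert_poly_top schubert_poly_low // expr1 mulrBr mulr1 mulrA -exprS.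
have -> : (2 * n - 1).+1 = (2 * n)%N by lia.
by rewrite mu_root (natrM C 2 2) -[_ * _ * mu]mulrA mulrAC mulfV ?pnatr_eq0 //
     mul1r mulr_natl mulr2n addrK.
Qed.

Lemma character_star_tau1 y :
  character mu (star c (tau n 1) y) = mu * character mu y.
Proof.
have -> : y = \sum_i y 0 i *: tau n i.
  rewrite {1}[y]row_sum_delta; apply: eq_bigr => i _; congr (_ *: _).
  by apply/rowP => j; rewrite !mxE eqxx eq_sym.
elim/big_rec: _ => [|i z _ IHz]; first by rewrite star0 character0 mulr0.
rewrite star_linear !character_linear IHz character_star_tau1_tau //.
by rewrite mulrDr mulrCA.
Qed.

(** The elements x such that x * y |-> chi(x) chi(y) for all y form a subspace,
    which contains tau_0 and, by associativity, is stable under multiplication by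
    tau_1. The Chevalley formula then yields each tau_p in turn. *)
Lemma character_star_tau p y : (p < 2 * n)%N ->
  character mu (star c (tau n p) y) = character mu (tau n p) * character mu y.
Proof.
have ev0 : character mu (tau n 0) = 1.
  by rewrite character_tau ?schubert_poly_low ?expr0 //; lia.
elim: p => [|p IHp] ltp; first by rewrite (qh_star1 hc) ev0 mul1r.
have ltp' : (p < 2 * n)%N := ltnW ltp.
have : character mu (star c (star c (tau n 1) (tau n p)) y)
    = character mu (star c (tau n 1) (tau n p)) * character mu y.
  by rewrite -(qh_starA hc) !character_star_tau1 IHp // mulrA.
have [lep | ltp1] := leqP (p + 2) n; first by rewrite (qh_chevalley_low hc).
have [eqp | neqp] := eqVneq p (n - 1)%N.
  have -> : p.+1 = n by lia.
  (* The Chevalley formula only gives 2 tau_n; the factor 2 is cancelled in C. *)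
  rewrite eqp (qh_chevalley_mid hc) (qh_starC hc) mulr2n starD !characterD.
  rewrite -!mulr2n -[in RHS](mulr_natl (character _ _)) -[LHS]mulr_natl -mulrA.
  by move/mulfI; rewrite pnatr_eq0 (qh_starC hc); apply.
have [lep | ltp2] := leqP p (2 * n - 3).
  by rewrite (qh_chevalley_high hc) //; lia.
(* tau_(2n-1) is obtained by subtracting the term q tau_0, already treated. *)
have -> : p = (2 * n - 2)%N by lia.
have -> : (2 * n - 2).+1 = (2 * n - 1)%N by lia.
rewrite (qh_chevalley_line hc) addrC (qh_starC hc) star_linear.
rewrite !character_linear.
rewrite (qh_starC hc y) (qh_star1 hc) ev0 hornerX !mul1r mulrDl mul1r.
by move/addrI; rewrite (qh_starC hc).
Qed.

End Characters.

(** * The spectrum of multiplication by a Schubert class *)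

(** The column (f_i(mu))_i is an eigenvector: its product with the i-th row of
    A(tau_p) is the character mu evaluated at tau_p * tau_i. *)
Lemma char_poly_quantum_mult (C : numClosedFieldType) (n : nat)
    (c : 'I_(2 * n) -> 'I_(2 * n) -> 'I_(2 * n) -> {poly int})
    (p : nat) (mus : seq C) :
    (2 <= n)%N -> quantum_cohomology C c -> (p < 2 * n)%N ->
    uniq mus -> size mus = (2 * n)%N ->
    (forall mu, mu \in mus -> mu ^+ (2 * n) = 4 * mu) ->
  char_poly (quantum_mult C c p)
    = \prod_(mu <- mus) ('X - ((schubert_poly C n p).[mu])%:P).
Proof.
move=> n_ge2 hc ltp uniq_mus size_mus root_mus.
pose W := \matrix_(i < 2 * n, j < 2 * n) (schubert_poly C n i).[mus`_j].
rewrite (@char_poly_eigenbasis _ _ _ W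
  (\row_j (schubert_poly C n p).[mus`_j])).
- rewrite (big_nth 0) size_mus big_mkord.
  by apply: eq_bigr => j _; rewrite mxE.
- apply: unitmx_horner => // i _; apply: size_schubert_poly.
  exact: leq_trans n_ge2.
apply/matrixP => i j; rewrite mul_mx_diag !mxE.
have root_j : mus`_j ^+ (2 * n) = 4 * mus`_j.
  by apply/root_mus/mem_nth; rewrite size_mus.
rewrite mulrC -!character_tau // -(character_star_tau n_ge2 hc root_j) //.
by apply: eq_bigr => k _; rewrite !mxE.
Qed.

(** All three cases of the theorem at once. Here b is the image a alpha^p of the
    root alpha = 4^(1/N), and the translation by e = 1 affects the class of a
    point only. *)
Lemma quantum_spectrum (C : numClosedFieldType) (n : nat)
    (c : 'I_(2 * n) -> 'I_(2 * n) -> 'I_(2 * n) -> {poly int}) (p : nat) :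
    (2 <= n)%N -> quantum_cohomology C c -> (1 <= p <= 2 * n - 1)%N ->
    let N := (2 * n - 1)%N in
    let d := gcdn p N in
    let a : C := if (p < n)%N then 1 else 2^-1 in
    let e : C := (p == N)%:R in
  exists b y, [/\ b ^+ (N %/ d) = a ^+ (N %/ d) * 2 ^+ (2 * p %/ d), b != 0,
    (N %/ d).-primitive_root y &
    char_poly (quantum_mult C c p)
      = \prod_(x <- [seq x - e | x <- 0 :: [seq b * y ^+ k | k <- iota 0 N]])
          ('X - x%:P)].
Proof.
move=> n_ge2 hc /andP[p_gt0 lep] N d a e.
have N_gt0 : (0 < N)%N by rewrite /N; lia.
have [z prim_z] := closed_prim_root_exists C N_gt0.
pose al : C := N.-root 4.
have alN : al ^+ N = 4 by rewrite rootCK.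
have al_neq0 : al != 0 by rewrite rootC_eq0 // pnatr_eq0.
have a_neq0 : a != 0.
  by rewrite /a; case: ifP => _; rewrite ?oner_eq0 // invr_eq0 pnatr_eq0.
have d_gt0 : (0 < d)%N by rewrite gcdn_gt0 p_gt0.
exists (a * al ^+ p), (z ^+ p); split.
- rewrite exprMn -exprM [in al ^+ _]muln_divCA_gcd; congr (_ * _).
  rewrite exprM alN -muln_divA ?dvdn_gcdl // exprM.
  by congr (_ ^+ _); rewrite -natrX.
- by rewrite mulf_neq0 ?expf_neq0.
- exact: exp_prim_root.
pose mus := 0 :: [seq al * z ^+ k | k <- iota 0 N].
rewrite (@char_poly_quantum_mult _ _ _ _ mus) //.
- rewrite /= !big_cons !big_map; congr (_ * _).
    congr ('X - _%:P); rewrite /schubert_poly !hornerE expr0n gtn_eqF //.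
    by rewrite mulr0 sub0r.
  apply: eq_bigr => k _; congr ('X - _%:P).
  rewrite /schubert_poly !hornerE exprMn exprAC -/e.
  by rewrite mulrA.
- lia.
- by rewrite /= (uniq_geometric _ prim_z) // leqnn (geometric_neq0 _ prim_z).
- by rewrite /= size_map size_iota /N; lia.
move=> mu; have -> : (2 * n)%N = N.+1 by rewrite /N; lia.
rewrite inE => /predU1P[-> | /mapP[k _ ->]]; first by rewrite expr0n mulr0.
rewrite exprS mulrC; congr (_ * _).
by rewrite exprMn alN exprAC (prim_expr_order prim_z) expr1n mulr1.
Qed.

Section Spectrum.

Variables (C : numClosedFieldType) (n : nat).
Variable c : 'I_(2 * n) -> 'I_(2 * n) -> 'I_(2 * n) -> {poly int}.
Hypothesis n_ge2 : (2 <= n)%N.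
Hypothesis hc : quantum_cohomology C c.
Variable p : nat.
Hypothesis hp : (1 <= p <= 2 * n - 1)%N.

Let N := (2 * n - 1)%N.
Let d := gcdn p N.
Let m := (N %/ d)%N.
Let A : 'M[C]_(2 * n) := quantum_mult C c p.

Let N_gt0 : (0 < N)%N.
Proof. rewrite /N; lia. Qed.

Let d_gt0 : (0 < d)%N.
Proof. by rewrite gcdn_gt0 N_gt0 orbT. Qed.

Let def_N : N = (d * m)%N.
Proof. by rewrite mulnC divnK ?dvdn_gcdr. Qed.

Lemma char_poly_quantum_mult_factor :
  let a : C := if (p < n)%N then 1 else 2^-1 in
  let Y : {poly C} := 'X + (p == N)%:R%:P in
  char_poly A = Y * (Y ^+ m - (a ^+ m * 2 ^+ (2 * p %/ d))%:P) ^+ d.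
Proof.
move=> a Y.
have [b [y [def_bm b_neq0 prim_y ->]]] := quantum_spectrum n_ge2 hc hp.
by rewrite -def_bm -(prod_shifted_geometric _ _ prim_y b_neq0) -[(d * _)%N]def_N.
Qed.

Lemma char_poly_quantum_mult_low : (p < n)%N ->
  char_poly A = 'X * ('X^m - (2 ^+ (2 * p %/ d))%:P) ^+ d.
Proof.
move=> ltpn; rewrite char_poly_quantum_mult_factor ltpn ltn_eqF; last by lia.
by rewrite addr0 expr1n mul1r.
Qed.

Lemma char_poly_quantum_mult_high : (n <= p < N)%N ->
  char_poly A = 'X * ('X^m - (2 ^+ ((2 * p - N) %/ d))%:P) ^+ d.
Proof.
move=> /andP[lenp ltpN]; rewrite char_poly_quantum_mult_factor.
rewrite ltnNge lenp ltn_eqF //= addr0.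
have -> : (2 * p %/ d)%N = (m + (2 * p - N) %/ d)%N.
  by rewrite -divnDl ?dvdn_gcdr // subnKC // /N; lia.
by rewrite exprD mulrA -exprMn mulVf ?pnatr_eq0 // expr1n mul1r.
Qed.

Lemma char_poly_quantum_mult_point : p = N ->
  char_poly A = ('X - 1) ^+ N * ('X + 1).
Proof.
move=> eqpN; have eq_d : d = N by rewrite /d eqpN gcdnn.
rewrite char_poly_quantum_mult_factor eqpN eqxx ifN; last by rewrite /N; lia.
have -> : m = 1%N by rewrite /m eq_d divnn N_gt0.
rewrite eq_d mulnK // !expr1 mulrC expr2 mulKf ?pnatr_eq0 //.
by rewrite -addrA -polyCB -[_ - 2]opprB addrK polyCN.
Qed.

(** Simplicity means that the progression b y^k does not repeat itself for k < N,
    i.e., that y = z^p is still of order N. *)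
Lemma simple_quantum_mult :
  (forall a : C, eigenvalue A a -> mup a (char_poly A) = 1%N) <-> coprime p N.
Proof.
have [b [y [_ b_neq0 prim_y def_char]]] := quantum_spectrum n_ge2 hc hp.
apply: iff_trans (simple_spectrum def_char) _.
rewrite map_inj_uniq; last exact: addIr.
rewrite cons_uniq (geometric_neq0 _ prim_y) // (uniq_geometric _ prim_y) //=.
rewrite -/N -/d -/m /coprime -/d {1}def_N -[leqRHS]mul1n.
rewrite leq_pmul2r ?(prim_order_gt0 prim_y) //.
by rewrite eqn_leq d_gt0 andbT.
Qed.

End Spectrum.

Theorem theorem1p1 (R : realType) (n : nat) (hn : (2 <= n)%N)
    (c : 'I_(2 * n) -> 'I_(2 * n) -> 'I_(2 * n) -> {poly int})
    (hc : quantum_cohomology R[i] c)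
    (p : nat) (hp : (1 <= p <= 2 * n - 1)%N) :
  let A : 'M[R[i]]_(2 * n) := quantum_mult R[i] c p in
  let d := gcdn p (2 * n - 1) in
  [/\ (p < n)%N ->
        char_poly A =
        'X * ('X^((2 * n - 1) %/ d) - (2 ^+ (2 * p %/ d))%:P) ^+ d,
      (n <= p < 2 * n - 1)%N ->
        char_poly A =
        'X * ('X^((2 * n - 1) %/ d)
              - (2 ^+ ((2 * p - (2 * n - 1)) %/ d))%:P) ^+ d,
      p = (2 * n - 1)%N ->
        char_poly A = ('X - 1) ^+ (2 * n - 1) * ('X + 1) &
      (forall a : R[i], eigenvalue A a -> mup a (char_poly A) = 1%N) <->
        coprime p (2 * n - 1)].
Proof.
split.
- exact: char_poly_quantum_mult_low.
- exact: char_poly_quantum_mult_high.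
- exact: char_poly_quantum_mult_point.
- exact: simple_quantum_mult.
Qed.
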